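(* Let $n\ge1$ and consider the $\mathbb{K}$-algebra map $$\Phi:\mathbb{K}[x_j,Y_{ij},W\mid1\le i\le n,\,0\le j\le n]\to\mathbb{K}[t_0^{\pm1},\dots,t_n^{\pm1},\,y_{ij}\mid1\le i,j\le n]$$ given by $x_j\mapsto t_j^{-1}$ for $0\le j\le n$, $W\mapsto\det[y_{ij}]_{1\le i,j\le n}\,t_0t_1\cdots t_n$, $Y_{i0}\mapsto\big(-\sum_{j=1}^ny_{ij}\big)t_0$, and $Y_{ij}\mapsto y_{ij}t_j$ for $1\le j\le n$. Then $$\ker(\Phi)=\Big\langle\sum_{j=0}^nx_jY_{ij},\ (-1)^j\det Y(j)-x_jW\ \Big|\ 1\le i\le n,\ 0\le j\le n\Big\rangle,$$ where $Y(j)$ is the $n\times n$ matrix obtained from $Y=[Y_{ij}]_{1\le i\le n,\,0\le j\le n}$ by deleting the column with index $j$.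
   Context: $\mathbb{K}$ is an algebraically closed field. *)

(* Defs.v *)
From HB Require Import structures.
From mathcomp Require Import all_boot all_order all_algebra.
From mathcomp Require Import boolp.
From mathcomp Require Import mpoly.

Set Implicit Arguments.
Unset Strict Implicit.
Unset Printing Implicit Defensive.

Import GRing.Theory.
Local Open Scope ring_scope.

Local Notation "x %:F" := (FracField.tofrac x) : ring_scope.

(* Partially Laurent polynomials: the polynomial ring in N variables over K in
   which the variables selected by P are made invertible, realized as the
   subring of the fraction field whose elements have a denominator that is a
   monomial in the variables selected by P. *)
Definition is_laurent (K : fieldType) (N : nat) (P : pred 'I_N) :
    pred {fraction {mpoly K[N]}} :=
  fun f => `[< exists m : 'X_{1..N}, (forall i, ~~ P i -> m i = 0%N) /\
               exists p : {mpoly K[N]}, f = p%:F / ('X_[m])%:F >].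

Section LaurentTheory.
Variables (K : fieldType) (N : nat) (P : pred 'I_N).
Local Notation L := (@is_laurent K N P).

Lemma is_laurent_mpoly (p : {mpoly K[N]}) : p%:F \in L.
Proof.
apply/asboolP; exists 0%MM; split=> [i _|]; first by rewrite mnm0E.
by exists p; rewrite mpolyX0 tofrac1 divr1.
Qed.

Lemma tofracX_neq0 (m : 'X_{1..N}) : ('X_[m] : {mpoly K[N]})%:F != 0.
Proof. by rewrite tofrac_eq0 -msupp_eq0 msuppX. Qed.

Fact is_laurent_subring : subring_closed L.
Proof.
split=> [|f g|f g]; first by rewrite -tofrac1 is_laurent_mpoly.
- move=> /asboolP[m [hm [p ->]]] /asboolP[k [hk [q ->]]]; apply/asboolP.
  exists (m + k)%MM; split=> [i iP|]; first by rewrite mnmDE hm ?hk.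
  exists (p * 'X_[k] - q * 'X_[m]); rewrite mpolyXD tofracM tofracB !tofracM.
  by rewrite -mulNr addf_div ?tofracX_neq0 // mulNr.
- move=> /asboolP[m [hm [p ->]]] /asboolP[k [hk [q ->]]]; apply/asboolP.
  exists (m + k)%MM; split=> [i iP|]; first by rewrite mnmDE hm ?hk.
  by exists (p * q); rewrite mpolyXD !tofracM mulf_div.
Qed.

HB.instance Definition _ :=
  GRing.isSubringClosed.Build {fraction {mpoly K[N]}} L is_laurent_subring.

Record laurent : predArgType :=
  Laurent { laurent_val : {fraction {mpoly K[N]}}; _ : laurent_val \in L }.

HB.instance Definition _ := [isSub for laurent_val].
HB.instance Definition _ := [Choice of laurent by <:].
HB.instance Definition _ := [SubChoice_isSubComNzRing of laurent by <:].

Definition laurent_unit : pred laurent :=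
  fun x => (val x != 0) && ((val x)^-1 \in L).

Definition laurent_inv (x : laurent) : laurent :=
  if laurent_unit x then insubd x (val x)^-1 else x.

Fact laurent_mulVr : {in laurent_unit, left_inverse 1 laurent_inv *%R}.
Proof.
move=> x ux; have /andP[x0 xV] := ux; rewrite /laurent_inv.
have -> : laurent_unit x by [].
by apply/val_inj; rewrite [LHS]rmorphM [RHS]rmorph1 /= insubdK ?mulVf.
Qed.

Fact laurent_unitP (x y : laurent) : y * x = 1 -> laurent_unit x.
Proof.
move=> /(congr1 val); rewrite [LHS]rmorphM [RHS]rmorph1 /= => yx1.
have x0 : val x != 0.
  by apply/eqP => x0; move/eqP: yx1; rewrite x0 mulr0 eq_sym oner_eq0.
have xV : (val x)^-1 = val y by apply: mulr1_eq; rewrite mulrC.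
by rewrite /laurent_unit x0 xV; apply: valP.
Qed.

Fact laurent_inv_out : {in [predC laurent_unit], laurent_inv =1 id}.
Proof. by move=> x /negbTE ux; rewrite /laurent_inv [laurent_unit x]ux. Qed.

HB.instance Definition _ := GRing.ComNzRing_hasMulInverse.Build laurent
  laurent_mulVr laurent_unitP laurent_inv_out.

Definition laurent_mpoly (p : {mpoly K[N]}) : laurent :=
  Laurent (is_laurent_mpoly p).

Fact laurent_mpoly_is_zmod_morphism : zmod_morphism laurent_mpoly.
Proof. by move=> p q; apply/val_inj; rewrite [RHS]rmorphB /= tofracB. Qed.

Fact laurent_mpoly_is_monoid_morphism : monoid_morphism laurent_mpoly.
Proof.
split=> [|p q]; apply/val_inj.
  by rewrite [RHS]rmorph1 /= tofrac1.
by rewrite [RHS]rmorphM /= tofracM.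
Qed.

HB.instance Definition _ := GRing.isZmodMorphism.Build {mpoly K[N]} laurent
  laurent_mpoly laurent_mpoly_is_zmod_morphism.
HB.instance Definition _ := GRing.isMonoidMorphism.Build {mpoly K[N]} laurent
  laurent_mpoly laurent_mpoly_is_monoid_morphism.

Definition laurent_scale (c : K) (x : laurent) : laurent :=
  laurent_mpoly c%:MP * x.

Fact laurent_scaleA a b x :
  laurent_scale a (laurent_scale b x) = laurent_scale (a * b) x.
Proof. by rewrite /laurent_scale mulrA mpolyCM rmorphM. Qed.
Fact laurent_scale1 : left_id 1 laurent_scale.
Proof. by move=> x; rewrite /laurent_scale mpolyC1 rmorph1 mul1r. Qed.
Fact laurent_scaleDr : right_distributive laurent_scale +%R.
Proof. by move=> c x y; rewrite /laurent_scale mulrDr. Qed.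
Fact laurent_scaleDl x : {morph laurent_scale^~ x : a b / a + b}.
Proof. by move=> a b; rewrite /laurent_scale mpolyCD rmorphD mulrDl. Qed.
HB.instance Definition _ := GRing.Zmodule_isLmodule.Build K laurent
  laurent_scaleA laurent_scale1 laurent_scaleDr laurent_scaleDl.

Fact laurent_scaleAl (a : K) (x y : laurent) : a *: (x * y) = a *: x * y.
Proof. exact: mulrA. Qed.
HB.instance Definition _ :=
  GRing.Lmodule_isLalgebra.Build K laurent laurent_scaleAl.

Fact laurent_scaleAr (a : K) (x y : laurent) : a *: (x * y) = x * (a *: y).
Proof. exact: mulrCA. Qed.
HB.instance Definition _ :=
  GRing.Lalgebra_isAlgebra.Build K laurent laurent_scaleAr.

Definition laurentX (i : 'I_N) : laurent := laurent_mpoly 'X_i.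

Lemma laurentX_unit i : P i -> laurentX i \is a GRing.unit.
Proof.
move=> Pi; apply/andP; split; first exact: tofracX_neq0.
apply/asboolP; exists U_(i)%MM; split=> [j Pj|].
  by rewrite mnm1E; case: eqP Pj => // <-; rewrite Pi.
by exists 1; rewrite tofrac1 div1r.
Qed.

End LaurentTheory.

Arguments laurent K {N} P.
Arguments laurentX K {N} P i.

Definition generated_ideal (R : comNzRingType) (I : finType) (g : I -> R)
    (f : R) : Prop :=
  exists c : I -> R, f = \sum_i c i * g i.

(* The variables of K[x_j, Y_ij, W] and of K[t_j^{+-1}, y_ij].  Indices ranging
   over 1, ..., n are elements of 'I_n (shifted by one), those ranging over
   0, ..., n are elements of 'I_n.+1; the nonzero elements of the latter are the
   lift ord0 j for j : 'I_n. *)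
Definition src_var (n : nat) : finType :=
  ('I_n.+1 + 'I_n * 'I_n.+1 + unit)%type.
Definition tgt_var (n : nat) : finType := ('I_n.+1 + 'I_n * 'I_n)%type.

Section Phi.
Variables (K : fieldType) (n : nat).

Definition src_ring := {mpoly K[#|src_var n|]}.

Definition vx (j : 'I_n.+1) : src_ring := 'X_(enum_rank (inl (inl j) : src_var n)).
Definition vY (i : 'I_n) (j : 'I_n.+1) : src_ring :=
  'X_(enum_rank (inl (inr (i, j)) : src_var n)).
Definition vW : src_ring := 'X_(enum_rank (inr tt : src_var n)).

Definition is_t_var : pred 'I_#|tgt_var n| :=
  fun k => if enum_val k is inl _ then true else false.

Definition tgt_ring := laurent K is_t_var.

Definition vt (j : 'I_n.+1) : tgt_ring :=
  laurentX K is_t_var (enum_rank (inl j : tgt_var n)).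
Definition vy (i j : 'I_n) : tgt_ring :=
  laurentX K is_t_var (enum_rank (inr (i, j) : tgt_var n)).

Definition Phi_var (v : src_var n) : tgt_ring :=
  match v with
  | inl (inl j) => (vt j)^-1
  | inl (inr (i, j)) =>
      if unlift ord0 j is Some j' then vy i j' * vt j
      else (- \sum_(j' < n) vy i j') * vt ord0
  | inr tt => \det (\matrix_(i < n, j < n) vy i j) * \prod_(j < n.+1) vt j
  end.

Definition Phi : src_ring -> tgt_ring :=
  mmap (in_alg tgt_ring) (fun k => Phi_var (enum_val k)).

HB.instance Definition _ := GRing.RMorphism.on Phi.

Fact Phi_is_scalable : scalable Phi.
Proof. by move=> c p; rewrite /Phi mmapZ /= mulr_algl. Qed.
HB.instance Definition _ :=
  GRing.isScalable.Build K src_ring tgt_ring *:%R Phi Phi_is_scalable.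

Lemma PhiX v : Phi 'X_(enum_rank v) = Phi_var v.
Proof. by rewrite /Phi mmapX mmap1U enum_rankK. Qed.

Lemma vt_unit j : vt j \is a GRing.unit.
Proof. by apply: laurentX_unit; rewrite /is_t_var enum_rankK. Qed.

Lemma Phi_x j : Phi (vx j) = (vt j)^-1.
Proof. exact: PhiX. Qed.

Lemma Phi_W :
  Phi vW = \det (\matrix_(i < n, j < n) vy i j) * \prod_(j < n.+1) vt j.
Proof. exact: PhiX. Qed.

Lemma Phi_Y0 i : Phi (vY i ord0) = (- \sum_(j < n) vy i j) * vt ord0.
Proof. by rewrite PhiX /= unlift_none. Qed.

Lemma Phi_Y i j : Phi (vY i (lift ord0 j)) = vy i j * vt (lift ord0 j).
Proof. by rewrite PhiX /= liftK. Qed.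

Definition Ymat : 'M[src_ring]_(n, n.+1) := \matrix_(i, j) vY i j.

Definition ker_gen (k : 'I_n + 'I_n.+1) : src_ring :=
  match k with
  | inl i => \sum_(j < n.+1) vx j * vY i j
  | inr j => (-1) ^+ j * \det (col' j Ymat) - vx j * vW
  end.

End Phi.

(* Main.v *)
(* Call a monomial x^a Y^b W^k standard if a_i b_ii = 0 for 1 <= i <= n and
   a_j k = 0 for all j.  Rewriting x_j W as a signed maximal minor of Y, and
   x_i Y_ii as minus the other terms of row i of the relation Y x = 0, shows that
   standard monomials span modulo the ideal.  Their images are linearly
   independent: give y_ij weight 1 if i <> j and 0 if i = j, and take the part of
   lowest weight.  Then Y_i0 becomes -y_ii t_0, the determinant becomes
   y_11 ... y_nn, all initial forms are monomials up to sign, and the exponents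
   a, b, k of a standard monomial can be recovered from its initial monomial. *)
Require Import Defs.
From mathcomp Require Import all_boot all_order all_algebra.
From mathcomp Require Import mpoly.
From mathcomp Require Import perm zify.

Set Implicit Arguments.
Unset Strict Implicit.
Unset Printing Implicit Defensive.

Import GRing.Theory.
Local Open Scope ring_scope.

(** * Closure properties of a finitely generated ideal *)

Section GeneratedIdeal.
Variables (R : comNzRingType) (I : finType) (g : I -> R).
Local Notation J := (generated_ideal g).

Lemma generated_ideal0 : J 0.
Proof. by exists (fun=> 0); rewrite big1 // => i _; rewrite mul0r. Qed.

Lemma generated_idealD a b : J a -> J b -> J (a + b).
Proof.
move=> [c ->] [d ->]; exists (fun i => c i + d i).
by rewrite -big_split; apply: eq_bigr => i _; rewrite mulrDl.
Qed.

Lemma generated_idealM a b : J b -> J (a * b).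
Proof.
move=> [c ->]; exists (fun i => a * c i).
by rewrite mulr_sumr; apply: eq_bigr => i _; rewrite mulrA.
Qed.

Lemma generated_ideal_gen i : J (g i).
Proof.
exists (fun k => (k == i)%:R); rewrite (bigD1 i) //= eqxx mul1r big1 ?addr0 //.
by move=> k /negbTE ->; rewrite mul0r.
Qed.

End GeneratedIdeal.

(** * Signed maximal minors of a matrix with a kernel vector *)

Definition signed_minor (R : comNzRingType) n (B : 'M[R]_(n, n.+1)) (j :
  'I_n.+1) : R :=
  (-1) ^+ j * \det (col' j B).

(* Prepending the row [v j *: e_k - v k *: e_j] to [B] gives a square matrix
   with [v] in its kernel, whose determinant is therefore annihilated by the
   entries of [v]. *)
Lemma signed_minor_proportional (R : comNzRingType) n (B : 'M[R]_(n, n.+1))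
    (v : 'cV_n.+1) i j k :
  B *m v = 0 ->
  v i 0 * (v j 0 * signed_minor B k) = v i 0 * (v k 0 * signed_minor B j).
Proof.
move=> Bv0; pose u l := v j 0 *+ (l == k) - v k 0 *+ (l == j).
have sum_u (F : 'I_n.+1 -> R) :
    \sum_l u l * F l = v j 0 * F k - v k 0 * F j.
  have sumD (c : R) h : \sum_l c *+ (l == h) * F l = c * F h.
    rewrite (bigD1 h) //= eqxx mulr1n big1 ?addr0 // => l /negbTE ->.
    by rewrite mulr0n mul0r.
  rewrite -!sumD -sumrB; apply: eq_bigr => l _.
  by rewrite /u mulrBl.
pose A : 'M[R]_n.+1 := \matrix_(a, l) oapp (B^~ l) (u l) (unlift ord0 a).
have Av0 : A *m v = 0.
  apply/matrixP => a b; rewrite ord1 !mxE.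
  case: (unliftP ord0 a) => [a' ->|->].
    have /matrixP/(_ a' 0) := Bv0; rewrite !mxE => e; rewrite -[RHS]e.
    by apply: eq_bigr => l _; rewrite !mxE liftK.
  under eq_bigr do rewrite !mxE unlift_none /=.
  by rewrite sum_u mulrC subrr.
have detA : \det A = v j 0 * signed_minor B k - v k 0 * signed_minor B j.
  rewrite (expand_det_row _ ord0) -sum_u; apply: eq_bigr => l _.
  rewrite !mxE unlift_none /cofactor /signed_minor /= add0n; congr (_ * (_ *
    \det _)).
  by apply/matrixP => a b; rewrite !mxE liftK.
have : \det A *: v = 0.
  by rewrite -mul_scalar_mx -mul_adj_mx -mulmxA Av0 mulmx0.
move=> /matrixP/(_ i 0); rewrite !mxE detA mulrC mulrBr => /eqP.
by rewrite subr_eq0 => /eqP.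
Qed.

Lemma det_col_scale (R : comNzRingType) n (A : 'M[R]_n) (t : 'I_n -> R) :
  \det (\matrix_(i, j) (A i j * t j)) = \det A * \prod_j t j.
Proof.
have -> : \matrix_(i, j) (A i j * t j) = A *m diag_mx (\row_j t j).
  by apply/matrixP => i j; rewrite mul_mx_diag !mxE.
by rewrite det_mulmx det_diag; congr (_ * _); apply: eq_bigr => j _; rewrite
  mxE.
Qed.

(** * Weights of monomials and polynomials with a monomial initial form *)

Section MonomialWeight.
Variables (K : fieldType) (N : nat) (w : 'I_N -> nat).
Implicit Types (p q : {mpoly K[N]}) (m : 'X_{1..N}).

Definition mnm_weight m : nat := \sum_i w i * m i.

Lemma mnm_weightD m1 m2 : mnm_weight (m1 + m2)%MM = (mnm_weight m1 +
  mnm_weight m2)%N.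
Proof.
by rewrite -big_split; apply: eq_bigr => i _; rewrite mnmDE mulnDr.
Qed.

Lemma mnm_weight0 : mnm_weight 0%MM = 0%N.
Proof. by apply: big1 => i _; rewrite mnm0E muln0. Qed.

Lemma mnm_weight1 i : mnm_weight U_(i)%MM = w i.
Proof.
rewrite /mnm_weight (bigD1 i) //= mnm1E eqxx muln1 big1 ?addn0 // => j /negbTE
  ji.
by rewrite mnm1E eq_sym ji muln0.
Qed.

Lemma mnm_weight_sum (I : finType) (F : I -> 'X_{1..N}) :
  mnm_weight (\sum_i F i)%MM = (\sum_i mnm_weight (F i))%N.
Proof. exact: (big_morph _ mnm_weightD mnm_weight0). Qed.

Definition weight_ge k p := forall m, (mnm_weight m < k)%N -> p@_m = 0.

Lemma weight_geW k l p : (k <= l)%N -> weight_ge l p -> weight_ge k p.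
Proof. by move=> kl pl m mk; apply: pl; apply: leq_trans kl. Qed.

Lemma weight_geD k p q : weight_ge k p -> weight_ge k q -> weight_ge k (p + q).
Proof. by move=> hp hq m mk; rewrite mcoeffD hp ?hq ?addr0. Qed.

Lemma weight_geZ k c p : weight_ge k p -> weight_ge k (c *: p).
Proof. by move=> hp m mk; rewrite mcoeffZ hp ?mulr0. Qed.

Lemma weight_ge_sum k (I : finType) (P : pred I) (F : I -> {mpoly K[N]}) :
  (forall i, P i -> weight_ge k (F i)) -> weight_ge k (\sum_(i | P i) F i).
Proof. by move=> hF m mk; rewrite raddf_sum big1 //= => i Pi; apply: hF. Qed.

Lemma weight_geX m k : (k <= mnm_weight m)%N -> weight_ge k 'X_[m].
Proof.
move=> km m' m'k; rewrite mcoeffX; case: eqP => // e.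
by move: m'k; rewrite -e ltnNge km.
Qed.

(** Every monomial of [p * q] is a product of monomials from the two supports, and weights add. *)
Lemma weight_geM k l p q :
  weight_ge k p -> weight_ge l q -> weight_ge (k + l) (p * q).
Proof.
move=> hp hq m mkl; apply/eqP; rewrite mcoeff_eq0; apply/negP => /msuppM_le.
case/allpairsP => -[a b] /= [ap bq e]; move: mkl; rewrite e mnm_weightD.
have ka : (k <= mnm_weight a)%N.
  by rewrite leqNgt; apply/negP => /hp /eqP; rewrite mcoeff_eq0 ap.
have lb : (l <= mnm_weight b)%N.
  by rewrite leqNgt; apply/negP => /hq /eqP; rewrite mcoeff_eq0 bq.
by rewrite ltnNge leq_add.
Qed.

(** The scalar [c] stays existential: linear independence uses only that it is nonzero. The
    remainder is strictly heavier than [m], so it does not contain [m]. *)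
Definition has_initial p m :=
  exists2 c : K, c != 0 & weight_ge (mnm_weight m).+1 (p - c *: 'X_[m]).

Lemma has_initialX m : has_initial 'X_[m] m.
Proof.
by exists 1; rewrite ?oner_eq0 // scale1r subrr => m' _; rewrite mcoeff0.
Qed.

Lemma has_initial_weight_ge p m : has_initial p m -> weight_ge (mnm_weight m) p.
Proof.
case=> c _ hp; rewrite -[p](subrK (c *: 'X_[m])); apply: weight_geD.
  by apply: weight_geW hp.
by apply: weight_geZ; apply: weight_geX.
Qed.

Lemma has_initialM p q m1 m2 :
  has_initial p m1 -> has_initial q m2 -> has_initial (p * q) (m1 + m2)%MM.
Proof.
move=> hp hq; have wq := has_initial_weight_ge hq.
case: hp hq => c c0 hp [d d0 hq]; exists (c * d); first by rewrite mulf_neq0.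
(* In each summand one factor has lost its initial term, which raises its weight bound by one. *)
have -> : p * q - (c * d) *: 'X_[m1 + m2] =
    (p - c *: 'X_[m1]) * q + (c *: 'X_[m1]) * (q - d *: 'X_[m2]).
  rewrite mpolyXD mulrBl mulrBr addrA subrK -scalerAl -scalerAr scalerA.
  by [].
rewrite mnm_weightD; apply: weight_geD; first by rewrite -addSn; apply:
  weight_geM.
by rewrite -addnS; apply: weight_geM => //; apply/weight_geZ/weight_geX.
Qed.

Lemma has_initial1 : has_initial 1 0%MM.
Proof. by rewrite -mpolyX0; apply: has_initialX. Qed.

Lemma has_initial_exp p m k : has_initial p m -> has_initial (p ^+ k) (m *+
  k)%MM.
Proof.
move=> hp; elim: k => [|k IHk]; first by rewrite expr0 mulm0n; apply:
  has_initial1.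
by rewrite exprS mulmS; apply: has_initialM.
Qed.

Lemma has_initial_prod (I : finType) (F : I -> {mpoly K[N]}) (e : I ->
  'X_{1..N}) :
  (forall i, has_initial (F i) (e i)) ->
  has_initial (\prod_i F i) (\sum_i e i)%MM.
Proof.
move=> hF; elim/big_rec2: _ => [|i p m _ hm]; first exact: has_initial1.
exact: has_initialM.
Qed.

(* The coefficient of a lightest initial monomial receives no other
   contribution. *)
Lemma has_initial_free (T : eqType) (s : seq T) (c : T -> K)
    (q : T -> {mpoly K[N]}) (e : T -> 'X_{1..N}) :
  uniq s -> {in s &, injective e} -> {in s, forall x, c x != 0} ->
  {in s, forall x, has_initial (q x) (e x)} ->
  \sum_(x <- s) c x *: q x = 0 -> s = [::].
Proof.
move=> us inj_e c0 hq sum0; case: s => // x0 s0 in us inj_e c0 hq sum0 *.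
set s := x0 :: s0 in us inj_e c0 hq sum0 *.
pose P k := has (fun x => mnm_weight (e x) == k) s.
have exP : exists k, P k.
  by exists (mnm_weight (e x0)); apply/hasP; exists x0; rewrite ?mem_head.
case: (ex_minnP exP) => k /hasP[x xs /eqP xk] kmin.
have [d d0 hx] := hq x xs.
have /(congr1 (mcoeff (e x))) := sum0.
rewrite raddf_sum (bigD1_seq x) //= big_seq_cond big1 ?addr0.
  have := hx (e x) (ltnSn _); rewrite mcoeffB !mcoeffZ mcoeffX eqxx mulr1.
  move/eqP; rewrite subr_eq0 mcoeff0 => /eqP -> /eqP.
  by rewrite mulf_eq0 (negbTE d0) (negbTE (c0 x xs)).
move=> y /andP[ys yx]; have [b _ hy] := hq y ys.
have xy : (mnm_weight (e x) < (mnm_weight (e y)).+1)%N.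
  by rewrite ltnS xk; apply: kmin; apply/hasP; exists y.
have := hy _ xy; rewrite mcoeffB !mcoeffZ mcoeffX; case: eqP => [exy|_].
  by case/eqP: yx; apply: inj_e.
by rewrite mulr0 subr0 => ->; rewrite mulr0.
Qed.

End MonomialWeight.

(** * The generators lie in the kernel of [Phi] *)

Section PhiGenerators.
Variables (K : fieldType) (n : nat).

(** After division by [t_j] the images of row [i] are [y_i1, ..., y_in] and, in column 0, minus
    their sum. *)
Lemma Phi_row_relation (i : 'I_n) : \sum_(j < n.+1) (vt K j)^-1 * Phi (vY K i
  j) = 0.
Proof.
rewrite big_ord_recl Phi_Y0 mulrCA mulVr ?vt_unit // mulr1.
rewrite [X in _ + X](eq_bigr (vy K i)) => [|j _]; first by rewrite addNr.
by rewrite Phi_Y mulrCA mulVr ?vt_unit // mulr1.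
Qed.

(** The image of [Y] kills the vector of the inverses of the [t_j], so its signed maximal minors are
    proportional to that vector. The minor omitting column 0 fixes the factor, which is the image of
    [W]. *)
Lemma Phi_ker_gen k : Phi (@ker_gen K n k) = 0.
Proof.
case: k => [i|j] /=.
  rewrite rmorph_sum /= -[RHS](Phi_row_relation i); apply: eq_bigr => j _.
  by rewrite rmorphM /= Phi_x.
rewrite rmorphB !rmorphM rmorphXn rmorphN1 /= Phi_x Phi_W -det_map_mx.
rewrite (map_col' _ (Ymat K n)).
set B := map_mx _ _; rewrite -/(signed_minor B j).
pose v : 'cV[tgt_ring K n]_n.+1 := \col_j (vt K j)^-1.
have Bv0 : B *m v = 0.
  apply/matrixP => i a; rewrite !mxE -[RHS](Phi_row_relation i).
  by apply: eq_bigr => l _; rewrite !mxE mulrC.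
have uV (l : 'I_n.+1) : (vt K l)^-1 \is a GRing.unit by rewrite unitrV vt_unit.
have := signed_minor_proportional ord0 ord0 j Bv0; rewrite !mxE.
(* Entries of [v] are units, so the factor that spoils proportionality over a general ring
   cancels. *)
move/(mulrI (uV ord0)) => e.
have -> : signed_minor B j = vt K ord0 * ((vt K j)^-1 * signed_minor B ord0).
  by rewrite -e mulVKr ?vt_unit.
(* Without column 0 the entries are [y_ij t_j], so each column gives up its factor [t_j]; the
   missing [t_0] comes from the previous rewriting. *)
have -> : signed_minor B ord0 =
    \det (\matrix_(i < n, j < n) vy K i j) * \prod_(j < n) vt K (lift ord0 j).
  rewrite /signed_minor expr0 mul1r -det_col_scale; congr (\det _).
  by apply/matrixP => i l; rewrite !mxE /= Phi_Y.
by rewrite big_ord_recl [X in X - _]mulrCA [vt K ord0 * (_ * _)]mulrCA subrr.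
Qed.

Lemma Phi_generated_ideal f : generated_ideal (@ker_gen K n) f -> Phi f = 0.
Proof.
move=> [c ->]; rewrite rmorph_sum big1 // => k _.
by rewrite rmorphM /= Phi_ker_gen mulr0.
Qed.

End PhiGenerators.

(** * Reduction to standard monomials modulo the ideal *)

Section StandardMonomials.
Variables (K : fieldType) (n : nat).

Definition x_index (j : 'I_n.+1) := enum_rank (inl (inl j) : src_var n).
Definition Y_index i (j : 'I_n.+1) := enum_rank (inl (inr (i, j)) : src_var n).
Definition W_index := enum_rank (inr tt : src_var n).

Definition standard (m : 'X_{1..#|src_var n|}) : bool :=
  [forall i, (m (x_index (lift ord0 i)) == 0%N) || (m (Y_index i (lift ord0
    i)) == 0%N)]
  && [forall j, (m (x_index j) == 0%N) || (m W_index == 0%N)].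

Definition reducible (f : src_ring K n) : Prop :=
  exists2 g : src_ring K n, {in msupp g, forall m, standard m} &
    generated_ideal (@ker_gen K n) (f - g).

Lemma reducible_standard m : standard m -> reducible 'X_[m].
Proof.
move=> sm; exists 'X_[m]; last by rewrite subrr; apply: generated_ideal0.
by move=> m'; rewrite msuppX inE => /eqP ->.
Qed.

Lemma reducible0 : reducible 0.
Proof.
exists 0; last by rewrite subrr; apply: generated_ideal0.
by move=> m'; rewrite -mpolyC0 msupp0.
Qed.

Lemma reducibleD f g : reducible f -> reducible g -> reducible (f + g).
Proof.
move=> [f' sf jf] [g' sg jg]; exists (f' + g'); last first.
  by rewrite opprD addrACA; apply: generated_idealD.
by move=> m /msuppD_le; rewrite mem_cat => /orP[/sf|/sg].
Qed.

Lemma reducibleZ c f : reducible f -> reducible (c *: f).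
Proof.
move=> [f' sf jf]; exists (c *: f'); first by move=> m /msuppZ_le /sf.
by rewrite -scalerBr -mul_mpolyC; apply: generated_idealM.
Qed.

Lemma reducible_sign k f : reducible f -> reducible ((-1) ^+ k * f).
Proof.
have -> : (-1) ^+ k * f = (-1) ^+ k *: f.
  by rewrite -mul_mpolyC rmorphXn rmorphN1.
exact: reducibleZ.
Qed.

Lemma reducible_sum (I : eqType) (s : seq I) (P : pred I) (F : I -> src_ring K
  n) :
  (forall i, P i -> reducible (F i)) -> reducible (\sum_(i <- s | P i) F i).
Proof.
move=> hF; elim/big_rec: _ => [|i p Pi hp]; first exact: reducible0.
by apply: reducibleD hp; apply: hF.
Qed.

Lemma reducible_congr f g :
  generated_ideal (@ker_gen K n) (f - g) -> reducible g -> reducible f.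
Proof.
move=> jfg [h sh jgh]; exists h => //.
by rewrite -[f](subrK g) -addrA; apply: generated_idealD.
Qed.

(* Replacing [x_j W] by a signed minor lowers this weight since the minor has
   degree [n]; replacing [x_i Y_ii] by the other terms of row [i] lowers it
   since they are off the diagonal. *)
Definition src_weight (k : 'I_#|src_var n|) : nat :=
  match enum_val k with
  | inl (inl _) => 0
  | inl (inr (i, j)) => j == lift ord0 i
  | inr _ => n.+1
  end.
Local Notation wt := (mnm_weight src_weight).

Lemma mpolyXM2 (m a b : 'X_{1..#|src_var n|}) :
  'X_[m + (a + b)] = 'X_[a] * 'X_[b] * 'X_[m] :> src_ring K n.
Proof. by rewrite addmC !mpolyXD. Qed.

Lemma mnm_split2 N (m : 'X_{1..N}) i j :
  i != j -> m i != 0%N -> m j != 0%N ->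
  exists m', m = (m' + (U_(i) + U_(j)))%MM.
Proof.
move=> /negbTE ij mi mj; exists (m - (U_(i) + U_(j)))%MM.
rewrite submK //; apply/mnm_lepP => k; rewrite mnmDE !mnm1E.
case: (i =P k) => [<-|_]; first by rewrite eq_sym ij addn0 lt0n.
by case: (j =P k) => [<-|//]; rewrite lt0n.
Qed.

(** Strong induction on [src_weight]: every rewriting of a nonstandard monomial yields monomials of
    smaller weight, up to sign. *)
Lemma reducible_mpolyX m : reducible 'X_[m].
Proof.
have [k] := ubnP (wt m); elim: k m => // k IHk m; rewrite ltnS => mk.
have [|] := boolP (standard m); first exact: reducible_standard.
(* A nonstandard monomial is divisible either by some [x_i Y_ii], treated first, or by some
   [x_j W]. *)
rewrite negb_and => /orP[|] /forallPn[j]; rewrite negb_or => /andP[mx mW].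
  have [|m' em] := mnm_split2 _ mx mW.
    by apply/eqP => /enum_rank_inj.
  rewrite {}em in mk *; rewrite mpolyXM2.
  apply: (@reducible_congr _ ((-1) ^+ 1 * (\sum_(l < n.+1 | l != lift ord0 j)
      vx K l * vY K j l) * 'X_[m'])).
    have := generated_idealM 'X_[m'] (generated_ideal_gen (@ker_gen K n) (inl
      j)).
    rewrite /= (bigD1 (lift ord0 j)) //= mulrC expr1 mulN1r mulNr opprK.
    by rewrite -mulrDl.
  rewrite -mulrA; apply: reducible_sign; rewrite mulr_suml.
  apply: reducible_sum => l lj.
  have -> : vx K l * vY K j l * 'X_[m'] =
      'X_[(m' + (U_(x_index l) + U_(Y_index j l)))] by rewrite mpolyXM2.
  apply: IHk; apply: leq_trans mk; rewrite !mnm_weightD !mnm_weight1.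
  by rewrite /src_weight !enum_rankK eqxx (negbTE lj) ltn_add2l.
have [|m' em] := mnm_split2 _ mx mW.
  by apply/eqP => /enum_rank_inj.
rewrite {}em in mk *; rewrite mpolyXM2.
apply: (@reducible_congr _ ((-1) ^+ j * \det (col' j (Ymat K n)) * 'X_[m'])).
  have := generated_idealM (- 'X_[m']) (generated_ideal_gen (@ker_gen K n)
    (inr j)).
  by rewrite /= mulrC mulrN mulrBl opprB.
rewrite -mulrA; apply: reducible_sign; rewrite mulr_suml.
(* In the Leibniz expansion of the minor each permutation contributes one signed monomial. *)
apply: reducible_sum => s _; rewrite -mulrA; apply: reducible_sign.
have -> : \prod_i col' j (Ymat K n) i (s i) * 'X_[m'] =
    'X_[(m' + \sum_i U_(Y_index i (lift j (s i))))].
  rewrite mpolyXD mulrC -mprodXE; congr (_ * _).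
  by apply: eq_bigr => i _; rewrite !mxE.
apply: IHk; apply: leq_trans mk; rewrite !mnm_weightD !mnm_weight1
  mnm_weight_sum.
rewrite ltn_add2l {2 3}/src_weight !enum_rankK ltnS.
(* The [n] factors weigh at most 1 each, against [n.+1] for the [W] they replace. *)
apply: (@leq_trans (\sum_(i < n) 1)); last by rewrite sum1_card card_ord.
by apply: leq_sum => i _; rewrite mnm_weight1 /src_weight enum_rankK leq_b1.
Qed.

Lemma reducible_all f : reducible f.
Proof.
rewrite [f]mpolyE; apply: reducible_sum => m _.
by apply: reducibleZ; apply: reducible_mpolyX.
Qed.

End StandardMonomials.

(** * Images cleared of denominators and their initial monomials *)

Section ClearedPhi.
Variables (K : fieldType) (n : nat).
Local Notation tgt_poly := {mpoly K[#|tgt_var n|]}.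

Definition t_index (j : 'I_n.+1) := enum_rank (inl j : tgt_var n).
Definition y_index (i j : 'I_n) := enum_rank (inr (i, j) : tgt_var n).

(** The value 1 at [x_j] is a placeholder: the negative power of [t_j] is accounted for in
    [cleared]. *)
Definition Phi_poly (v : src_var n) : tgt_poly :=
  match v with
  | inl (inl j) => 1
  | inl (inr (i, j)) =>
      if unlift ord0 j is Some j' then 'X_(y_index i j') * 'X_(t_index j)
      else (- \sum_j' 'X_(y_index i j')) * 'X_(t_index ord0)
  | inr tt =>
      \det (\matrix_(i, j) 'X_(y_index i j)) * \prod_j 'X_(t_index j)
  end.

(** This stands for the image of the monomial times the [M]-th power of [t_0 ... t_n]. The truncated
    subtraction is exact only when [M] bounds all the exponents of the [x_j]. *)
Definition cleared (M : nat) (m : 'X_{1..#|src_var n|}) : tgt_poly :=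
  (\prod_v Phi_poly v ^+ m (enum_rank v)) *
  \prod_j 'X_(t_index j) ^+ (M - m (x_index j)).

Lemma laurent_mpoly_inj N (P : pred 'I_N) :
  injective (@laurent_mpoly K N P).
Proof. by move=> p q /(congr1 val) /= /eqP; rewrite tofrac_eq => /eqP. Qed.

Lemma Phi_mpolyX m :
  Phi ('X_[m] : src_ring K n) = \prod_v Phi_var K v ^+ m (enum_rank v).
Proof.
rewrite /Phi mmapX /mmap1 (reindex (@enum_rank (src_var n))) /=.
  by apply: eq_bigr => v _; rewrite enum_rankK.
exact/onW_bij/enum_rank_bij.
Qed.

Lemma Phi_cleared M (m : 'X_{1..#|src_var n|}) : (forall j : 'I_n.+1, m
  (x_index j) <= M)%N ->
  Phi ('X_[m] : src_ring K n) * \prod_j vt K j ^+ M =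
  laurent_mpoly (@is_t_var n) (cleared M m).
Proof.
move=> mM; rewrite Phi_mpolyX /cleared rmorphM !rmorph_prod /=.
have PhiE (v : src_var n) : ~~ (if v is inl (inl _) then true else false) ->
    Phi_var K v = laurent_mpoly (@is_t_var n) (Phi_poly v).
  case: v => [[//|[i j]]|[]] _ /=.
    case: unliftP => [j' ->|_]; rewrite rmorphM //=.
    by rewrite rmorphN rmorph_sum.
  rewrite rmorphM rmorph_prod /= -det_map_mx; congr (\det _ * _).
  by apply/matrixP => i j; rewrite !mxE.
rewrite !big_sumType /= [X in _ = X * _ * _ * _]big1 => [|j _]; last first.
  by rewrite expr1n rmorph1.
rewrite mul1r mulrC !mulrA -big_split /= [RHS]mulrC mulrA.
congr (_ * _ * _); apply: eq_bigr => v _; last 2 first.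
- by rewrite rmorphXn; congr (_ ^+ _); apply: (PhiE (inl (inr v))).
- by rewrite rmorphXn; congr (_ ^+ _); apply: (PhiE (inr v)).
(* Splitting off from [t_j ^+ M] as many factors as [x_j] occurs cancels the inverse powers. *)
rewrite rmorphXn /= -{1}(subnK (mM v)) exprD exprVn -mulrA mulrV ?mulr1 //.
by rewrite unitrX ?vt_unit.
Qed.

(** In column 0 [unlift] gives [None], and [odflt] selects the diagonal variable [y_ii], the only
    summand of weight 0 in the image of [Y_i0]. *)
Definition lead_var (v : src_var n) : 'X_{1..#|tgt_var n|} :=
  match v with
  | inl (inl j) => 0%MM
  | inl (inr (i, j)) =>
      (U_(y_index i (odflt i (unlift ord0 j))) + U_(t_index j))%MM
  | inr tt => (\sum_i U_(y_index i i) + \sum_j U_(t_index j))%MM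
  end.

Definition lead M (m : 'X_{1..#|src_var n|}) : 'X_{1..#|tgt_var n|} :=
  (\sum_v lead_var v *+ m (enum_rank v) +
   \sum_j U_(t_index j) *+ (M - m (x_index j)))%MM.

Definition tgt_weight (k : 'I_#|tgt_var n|) : nat :=
  if enum_val k is inr (i, j) then i != j else 0%N.

Lemma has_initial_row i :
  has_initial tgt_weight (- \sum_j 'X_(y_index i j) : tgt_poly) U_(y_index i
    i)%MM.
Proof.
exists (-1); rewrite ?oppr_eq0 ?oner_eq0 // mnm_weight1 /tgt_weight enum_rankK
  eqxx.
rewrite (bigD1 i) //= scaleN1r opprK opprD addrAC addNr add0r -scaleN1r.
apply: weight_geZ; apply: weight_ge_sum => j ji; apply: weight_geX.
by rewrite mnm_weight1 /tgt_weight enum_rankK eq_sym ji.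
Qed.

Lemma has_initial_det :
  has_initial tgt_weight (\det (\matrix_(i, j) 'X_(y_index i j)) : tgt_poly)
    (\sum_i U_(y_index i i))%MM.
Proof.
exists 1; rewrite ?oner_eq0 // mnm_weight_sum big1 => [|i _]; last first.
  by rewrite mnm_weight1 /tgt_weight enum_rankK eqxx.
have termE (s : {perm 'I_n}) :
    \prod_i (\matrix_(i, j) 'X_(y_index i j) : 'M[tgt_poly]_n) i (s i) =
    'X_[\sum_i U_(y_index i (s i))].
  by rewrite -mprodXE; apply: eq_bigr => i _; rewrite mxE.
rewrite /determinant (bigD1 (1%g : {perm 'I_n})) //= odd_perm1 expr0 mul1r
  termE scale1r.
rewrite (eq_bigr (fun i => U_(y_index i i)%MM)) => [|i _]; last by rewrite
  perm1.
rewrite addrAC subrr add0r; apply: weight_ge_sum => s s1; rewrite termE.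
have -> : (-1) ^+ s = ((-1) ^+ s)%:MP :> tgt_poly by rewrite rmorphXn rmorphN1.
rewrite mul_mpolyC; apply/weight_geZ/weight_geX.
(* A term of weight 0 uses diagonal variables only, so its permutation is the identity. *)
rewrite mnm_weight_sum lt0n; apply: contraNneq s1 => /eqP.
rewrite sum_nat_eq0 => /forallP s1; apply/eqP/permP => i; rewrite perm1.
have := s1 i; rewrite mnm_weight1 /tgt_weight enum_rankK eqb0 negbK /=.
by move/eqP.
Qed.

Lemma has_initial_cleared M m :
  has_initial tgt_weight (cleared M m) (lead M m).
Proof.
apply: has_initialM; last first.
  by apply: has_initial_prod => j; apply/has_initial_exp/has_initialX.
apply: has_initial_prod => v; apply: has_initial_exp; case: v => [[j|[i
  j]]|[]] /=; first exact: has_initial1.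
  case: unliftP => [j' _|->] /=; apply: has_initialM; try exact: has_initialX.
  exact: has_initial_row.
apply: has_initialM; first exact: has_initial_det.
by apply: has_initial_prod => j; apply: has_initialX.
Qed.

(** * Exponents of the initial monomials *)

Lemma sum_delta (I : finType) (F : I -> nat) i :
  (\sum_j (j == i) * F j)%N = F i.
Proof.
rewrite (bigD1 i) //= eqxx mul1n big1 ?addn0 // => j /negbTE ->.
by rewrite mul0n.
Qed.

Lemma big_src_var (F : src_var n -> nat) :
  (\sum_v F v = \sum_j F (inl (inl j)) + \sum_i \sum_j F (inl (inr (i, j)))
     + F (inr tt))%N.
Proof.
rewrite !big_sumType /= pair_bigA /=; congr (_ + _ + _)%N.
  by apply: eq_bigr => -[].
by rewrite (big_pred1 tt) // => -[].
Qed.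

Lemma mnm1_yy i j k l :
  (U_(y_index i j)%MM (y_index k l) = (i == k) * (j == l) :> nat)%N.
Proof. by rewrite mnm1E (inj_eq enum_rank_inj) mulnb -xpair_eqE. Qed.

Lemma mnm1_yt i j k : U_(y_index i j)%MM (t_index k) = 0%N.
Proof. by rewrite mnm1E (inj_eq enum_rank_inj). Qed.

Lemma mnm1_ty i j k : U_(t_index k)%MM (y_index i j) = 0%N.
Proof. by rewrite mnm1E (inj_eq enum_rank_inj). Qed.

Lemma mnm1_tt k l : U_(t_index k)%MM (t_index l) = (k == l).
Proof. by rewrite mnm1E (inj_eq enum_rank_inj). Qed.

(** Besides [Y_ij] itself, only [Y_i0] and [W] have a [y] of row [i] in their initial monomial,
    namely [y_ii]. *)
Lemma lead_y M m (i j : 'I_n) :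
  lead M m (y_index i j) =
  (m (Y_index i (lift ord0 j)) + (i == j) * (m (Y_index i ord0) + m (W_index
    n)))%N.
Proof.
rewrite mnmDE !mnm_sumE [X in (_ + X)%N]big1 => [|k _]; last first.
  by rewrite mulmnE mnm1_ty.
rewrite (eq_bigr _ (fun v _ => mulmnE _ _ _)) addn0 big_src_var /=.
rewrite big1 => [|k _]; last by rewrite mnm0E.
rewrite add0n mnmDE !mnm_sumE [X in (_ + (_ + X) * _)%N]big1 => [|k _]; last
  first.
  exact: mnm1_ty.
under [X in (_ + (X + _) * _)%N]eq_bigr do rewrite mnm1_yy.
rewrite sum_delta addn0 mulnDr addnA; congr (_ + _)%N.
rewrite -(sum_delta (fun k => m (Y_index k (lift ord0 j)) + (k == j) * m
  (Y_index k ord0))%N i).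
apply: eq_bigr => k _; rewrite big_ord_recl unlift_none /=.
rewrite mnmDE mnm1_yy mnm1_ty addn0 -mulnA addnC mulnDr; congr (_ + _)%N.
rewrite -(sum_delta (fun l => m (Y_index k (lift ord0 l))) j) big_distrr /=.
by apply: eq_bigr => l _; rewrite liftK mnmDE mnm1_yy mnm1_ty addn0 mulnA.
Qed.

Lemma lead_t M m j :
  lead M m (t_index j) =
  (\sum_i m (Y_index i j) + m (W_index n) + (M - m (x_index j)))%N.
Proof.
rewrite mnmDE !mnm_sumE (eq_bigr _ (fun v _ => mulmnE _ _ _)); congr (_ + _)%N.
  rewrite big_src_var /= big1 => [|k _]; last by rewrite mnm0E.
  rewrite add0n mnmDE !mnm_sumE [X in (_ + (X + _) * _)%N]big1 => [|k _].
    rewrite add0n (eq_bigr _ (fun k _ => mnm1_tt k j)); congr (_ + _)%N.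
      apply: eq_bigr => i _; rewrite -(sum_delta (fun l => m (Y_index i l)) j).
      by apply: eq_bigr => l _; rewrite mnmDE mnm1_yt mnm1_tt.
    under eq_bigr do rewrite -[(_ == _ : nat)]muln1.
    by rewrite (sum_delta (fun=> 1%N)) mul1n.
  exact: mnm1_yt.
rewrite -(sum_delta (fun l => (M - m (x_index l))%N) j).
by apply: eq_bigr => l _; rewrite mulmnE mnm1_tt.
Qed.

Lemma standardP (m : 'X_{1..#|src_var n|}) :
  standard m ->
  (forall i : 'I_n, m (x_index (lift ord0 i)) = 0%N \/ m (Y_index i (lift ord0
    i)) = 0%N)
  /\ (forall j : 'I_n.+1, m (x_index j) = 0%N \/ m (W_index n) = 0%N).
Proof.
by case/andP => /forallP h1 /forallP h2; split=> i; [have:= h1 i|have := h2 i];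
  case/orP => /eqP ->; auto.
Qed.

(** * Recovering a standard monomial from its initial monomial *)

Section LeadInjective.
Variables (M : nat) (m m' : 'X_{1..#|src_var n|}).
Hypothesis e : lead M m = lead M m'.

Lemma lead_inj_offdiag (i j : 'I_n) : i != j ->
  m (Y_index i (lift ord0 j)) = m' (Y_index i (lift ord0 j)).
Proof.
move=> /negbTE ij; have /mnmP/(_ (y_index i j)) := e.
by rewrite !lead_y ij !mul0n !addn0.
Qed.

Lemma lead_inj_diag (i : 'I_n) :
  (m (Y_index i (lift ord0 i)) + (m (Y_index i ord0) + m (W_index n)) =
   m' (Y_index i (lift ord0 i)) + (m' (Y_index i ord0) + m' (W_index n)))%N.
Proof. by have /mnmP/(_ (y_index i i)) := e; rewrite !lead_y eqxx !mul1n. Qed.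

(** The off-diagonal exponents in this column already agree, so they cancel when the exponents of
    [t_i] are compared. *)
Lemma lead_inj_column (i : 'I_n) :
  (m (Y_index i (lift ord0 i)) + m (W_index n) + (M - m (x_index (lift ord0
    i))) =
   m' (Y_index i (lift ord0 i)) + m' (W_index n) + (M - m' (x_index (lift ord0
     i))))%N.
Proof.
have /mnmP/(_ (t_index (lift ord0 i))) := e; rewrite !lead_t.
rewrite (bigD1 i) //= [in RHS](bigD1 i) //=.
rewrite (eq_bigr _ (fun k => @lead_inj_offdiag k i)).
by set S := (\sum_(_ | _) _)%N; lia.
Qed.

Lemma lead_inj_column0 :
  (\sum_i m (Y_index i ord0) + m (W_index n) + (M - m (x_index ord0)) =
   \sum_i m' (Y_index i ord0) + m' (W_index n) + (M - m' (x_index ord0)))%N.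
Proof. by have /mnmP/(_ (t_index ord0)) := e; rewrite !lead_t. Qed.

(** If [W] had the larger exponent in [m], it would be positive there, so no [x_j] would divide [m].
    The column and diagonal equations then bound each exponent of [Y_i0] in [m'] by that in [m], and
    the exponent of [t_0] would be strictly larger for [m]. *)
Lemma lead_inj_W : standard m -> (m (W_index n) <= m' (W_index n))%N.
Proof.
case/standardP => _ xW; rewrite leqNgt; apply/negP => ltW.
have x0 j : m (x_index j) = 0%N by have := xW j; lia.
have leY0 : (\sum_i m' (Y_index i ord0) <= \sum_i m (Y_index i ord0))%N.
  apply: leq_sum => i _; have := lead_inj_diag i; have := lead_inj_column i.
  by rewrite x0; lia.
by have := lead_inj_column0; rewrite x0; lia.
Qed.

End LeadInjective.

Lemma lead_inj M (m m' : 'X_{1..#|src_var n|}) :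
  (forall j : 'I_n.+1, m (x_index j) <= M)%N ->
  (forall j : 'I_n.+1, m' (x_index j) <= M)%N ->
  standard m -> standard m' -> lead M m = lead M m' -> m = m'.
Proof.
move=> mM m'M sm sm' e.
have eW : m (W_index n) = m' (W_index n).
  by apply/eqP; rewrite eqn_leq (lead_inj_W e sm) (lead_inj_W (esym e) sm').
have [[xY _] [xY' _]] := (standardP sm, standardP sm').
(* With equal [W] exponents, the exponent of [Y_ii] minus that of [x_i] agrees for both monomials.
   One of the two exponents vanishes, so the difference determines both. *)
have eYx (i : 'I_n) : m (Y_index i (lift ord0 i)) = m' (Y_index i (lift ord0
  i)) /\
    m (x_index (lift ord0 i)) = m' (x_index (lift ord0 i)).
  have := lead_inj_column e i; have := xY i; have := xY' i.
  by have := mM (lift ord0 i); have := m'M (lift ord0 i); lia.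
have eY0 (i : 'I_n) : m (Y_index i ord0) = m' (Y_index i ord0).
  by have := lead_inj_diag e i; have [-> _] := eYx i; lia.
apply/mnmP => k; rewrite -[k]enum_valK.
case: (enum_val k) => [[j|[i j]]|[]]; last exact: eW.
  case: (unliftP ord0 j) => [i ->|->]; first by have [_] := eYx i.
  have := lead_inj_column0 e; rewrite (eq_bigr _ (fun i _ => eY0 i)) eW.
  move=> /addnI E; have := mM ord0; have := m'M ord0.
  (* The bound [M] makes the truncated subtraction invertible, which recovers the exponent of
     [x_0]. *)
  by move=> leM' leM; rewrite -[LHS]/(m (x_index ord0)) -(subKn leM) E subKn.
case: (unliftP ord0 j) => [l ->|->]; last exact: eY0.
by case: (eqVneq i l) => [->|/(lead_inj_offdiag e)//]; have [] := eYx l.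
Qed.

Lemma standard_Phi_eq0 (g : src_ring K n) :
  {in msupp g, forall m, standard m} -> Phi g = 0 -> g = 0.
Proof.
(* A single [M] bounds the [x] exponents of all monomials of [g], so one power of [t_0 ... t_n]
   clears every denominator. *)
move=> sg Pg0; pose M := \max_(m <- msupp g) \max_(j < n.+1) m (x_index j).
have le_M m : m \in msupp g -> forall j : 'I_n.+1, (m (x_index j) <= M)%N.
  move=> mg j; apply: leq_trans (leq_bigmax_seq _ mg isT).
  exact: (leq_bigmax (F := fun j => m (x_index j))).
suff : msupp g = [::] by apply: msuppnil0.
apply: (@has_initial_free K _ tgt_weight _ (msupp g) (fun m => g@_m) (cleared
  M) (lead M)).
- exact: msupp_uniq.
- by move=> m m' mg m'g; apply: lead_inj; auto.
- by move=> m; rewrite mcoeff_msupp.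
- by move=> m _; apply: has_initial_cleared.
(* The remaining relation between cleared images is checked in the Laurent ring, where it is
   [Phi g = 0] times that power. *)
apply: (@laurent_mpoly_inj _ (@is_t_var n)); rewrite rmorph0.
rewrite -[RHS](mul0r (\prod_j vt K j ^+ M)) -Pg0 [in RHS](mpolyE g).
rewrite !raddf_sum mulr_suml /= big_seq [RHS]big_seq.
apply: eq_bigr => m mg; rewrite [Phi _]linearZ /= -scalerAl.
by rewrite (Phi_cleared (le_M m mg)) -mul_mpolyC rmorphM.
Qed.

End ClearedPhi.

Theorem proposition6p5 (K : closedFieldType) (n : nat) (hn : (1 <= n)%N) :
  forall f : src_ring K n, Phi f = 0 <-> generated_ideal (@ker_gen K n) f.
Proof.
move=> f; split=> [f0|]; last exact: Phi_generated_ideal.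
(* The standard representative [g] differs from [f] by an element of the ideal, hence of the kernel;
   so [Phi g = 0], which forces [g = 0]. *)
have [g sg jfg] := reducible_all f.
suff g0 : g = 0 by rewrite g0 subr0 in jfg.
apply: standard_Phi_eq0 sg _.
by have := Phi_generated_ideal jfg; rewrite rmorphB /= f0 sub0r => /eqP;
  rewrite oppr_eq0 => /eqP.
Qed.
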